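(* For all but finitely many non-negative integers $r$, $|\gamma_1(\mathcal{P}_{r+1})|>|\gamma_1(\mathcal{P}_{r})|$.
   Context: $\mathcal{P}_r$ is the set of the first $r$ primes and $q_r=\prod_{p\in\mathcal{P}_r}p$ (with $q_0=1$). With $\chi_0$ the principal Dirichlet character modulo $q_r$, the constants $\gamma_k(\mathcal{P}_r)$ are defined by the Laurent expansion $L(s,\chi_0)=\frac{\phi(q_r)}{q_r(s-1)}+\sum_{k\ge0}\frac{(-1)^k\gamma_k(\mathcal{P}_r)}{k!}(s-1)^k$ at $s=1$; equivalently $\gamma_1(\mathcal{P}_r)=\lim_{x\to\infty}\Big(\sum_{n\le x,\ \gcd(n,q_r)=1}\frac{\log n}{n}-\prod_{p\in\mathcal{P}_r}(1-\frac1p)\frac{\log^2x}{2}\Big)$. *)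

(* Defs.v *)
From Stdlib Require Import Reals.
From Coquelicot Require Import Coquelicot.
From mathcomp Require Import all_boot.

Lemma ex_prime_above (m : nat) : exists p, (m < p)%N && prime p.
Proof. by have [p lt_mp p_pr] := prime_above m; exists p; rewrite lt_mp. Qed.

Definition next_prime (m : nat) : nat := ex_minn (ex_prime_above m).

(* Zero-based: nth_prime 0 = 2, nth_prime 1 = 3, nth_prime 2 = 5. *)
Definition nth_prime (i : nat) : nat := iter i next_prime 2%N.

Definition first_primes (r : nat) : seq nat := mkseq nth_prime r.

Definition primorial (r : nat) : nat := (\prod_(p <- first_primes r) p)%N.

Definition principal_char (q n : nat) : C :=
  if coprime n q then RtoC 1 else RtoC 0.

Definition Cexp (z : C) : C :=
  (exp (Re z) * cos (Im z), exp (Re z) * sin (Im z))%R.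

(* n^(-s); only meaningful for n >= 1. *)
Definition npow_opp (n : nat) (s : C) : C :=
  Cexp (- (s * RtoC (ln (INR n))))%C.

(* L is the function s |-> L(s, chi_0), chi_0 principal modulo q: the
   Dirichlet series on Re s > 1, continued holomorphically to C \ {1}.  The
   index is shifted because series start at 0 and the Dirichlet series at 1. *)
Definition is_principal_L (q : nat) (L : C -> C) : Prop :=
  (forall s : C, (1 < Re s)%R ->
     is_series (K := C_AbsRing) (V := C_NormedModule)
       (fun n => (principal_char q n.+1 * npow_opp n.+1 s)%C) (L s)) /\
  (forall s : C, s <> RtoC 1 ->
     ex_derive (K := C_AbsRing) (V := C_NormedModule) L s).

(* g is the sequence (gamma_k(P_r))_k: in a punctured disc around 1,
   L(s, chi_0) - phi(q_r) / (q_r (s - 1))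
     = sum_k (-1)^k g_k / k! (s - 1)^k.
   Both L and g are uniquely determined by r. *)
Definition is_gamma (r : nat) (g : nat -> R) : Prop :=
  exists L : C -> C,
    is_principal_L (primorial r) L /\
    exists eps : posreal, forall s : C,
      (0 < Cmod (s - RtoC 1) < eps)%R ->
      is_pseries (K := C_AbsRing) (V := C_NormedModule)
        (fun k => RtoC ((-1) ^ k * g k / INR (k`!))%R)
        (s - RtoC 1)%C
        (L s - RtoC (INR (totient (primorial r)))
               / (RtoC (INR (primorial r)) * (s - RtoC 1)))%C.

(* Main.v *)
(* Write A_r = phi(q_r) / q_r, gamma_0(P_r) = A_r h_r, gamma_1(P_r) = - A_r G_r.
   Letting s -> 1+ along the reals in L_{r+1}(s) = (1 - p^{-s}) L_r(s), with
   p = p_{r+1}, gives for a = ln p / (p - 1)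
     A_{r+1} = A_r (1 - 1/p),   h_{r+1} = h_r + a,
     G_{r+1} = G_r + a (h_r - ln p / 2),
   whence A_{r+1} G_{r+1} > A_r G_r iff (h_r - ln p)^2 < V_r := h_r^2 - 2 G_r.
   By Mertens' first theorem h_r - ln p_{r+1} is bounded, while
   V_{r+1} - V_r = a (a + ln p) sums to infinity.  The same bound makes G_r
   eventually increase by at least a, so G_r is eventually nonnegative and the
   absolute values can be dropped. *)
From HB Require Import structures.
Require Import Defs.
From Stdlib Require Import Reals Lra.
From Coquelicot Require Import Coquelicot.
From mathcomp Require Import all_boot zify.

Set Implicit Arguments.
Unset Strict Implicit.
Unset Printing Implicit Defensive.

Local Open Scope R_scope.

(** * Mertens' first theorem *)

HB.instance Definition _ := Monoid.isComLaw.Build R 0 Rplus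
  (fun x y z => esym (Rplus_assoc x y z)) Rplus_comm Rplus_0_l.

Lemma Rsum_le I (s : seq I) (P : pred I) (F G : I -> R) :
  (forall i, P i -> F i <= G i) ->
  \big[Rplus/0]_(i <- s | P i) F i <= \big[Rplus/0]_(i <- s | P i) G i.
Proof.
move=> FG; apply: (big_ind2 Rle) => //; first exact: Rle_refl.
by move=> *; apply: Rplus_le_compat.
Qed.

Lemma Rsum_mull I (s : seq I) (P : pred I) (c : R) (F : I -> R) :
  \big[Rplus/0]_(i <- s | P i) (c * F i) = c * \big[Rplus/0]_(i <- s | P i) F i.
Proof.
rewrite (big_morph (fun x => c * x) (Rmult_plus_distr_l c) (Rmult_0_r c)).
by [].
Qed.

(** * Logarithm and prime exponents of a factorial *)

Lemma ln_prod I (s : seq I) (P : pred I) (F : I -> nat) :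
  (forall i, P i -> (0 < F i)%N) ->
  ln (INR (\prod_(i <- s | P i) F i)) = \big[Rplus/0]_(i <- s | P i) ln (INR (F i)).
Proof.
move=> F0.
suff [] : (0 < \prod_(i <- s | P i) F i)%N /\
  ln (INR (\prod_(i <- s | P i) F i)) = \big[Rplus/0]_(i <- s | P i) ln (INR (F i)) by [].
apply: (big_ind2 (fun x y => (0 < x)%N /\ ln (INR x) = y)).
- by split=> //; rewrite ln_1.
- move=> x1 x2 y1 y2 [x0 <-] [y0 <-]; split; first by rewrite muln_gt0 x0.
  by rewrite mult_INR ln_mult //; apply: lt_0_INR; lia.
- by move=> i /F0.
Qed.

Lemma INR_expn m k : INR (m ^ k) = INR m ^ k.
Proof. by elim: k => // k IH; rewrite expnS mult_INR IH. Qed.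

Lemma ln_expn m k : (0 < m)%N -> ln (INR (m ^ k)) = INR k * ln (INR m).
Proof.
by move=> m0; rewrite INR_expn ln_pow //; apply: lt_0_INR; lia.
Qed.

Lemma ln_nat_ge0 m : 0 <= ln (INR m).
Proof.
case: m => [|m].
  (* [ln] takes the default value 0 at 0. *)
  by rewrite /ln; case: Rlt_dec => [H|_]; [case: (Rlt_irrefl _ H)|exact: Rle_refl].
rewrite -ln_1; apply: ln_le; first lra.
by rewrite S_INR; have := pos_INR m; lra.
Qed.

Lemma ln_le_sub1 x : 0 < x -> ln x <= x - 1.
Proof.
move=> x0; have := exp_ineq1_le (ln x); rewrite exp_ln //; lra.
Qed.

(** Logarithm of the prime factorisation. The range reaches up to [n] rather than [m] so that all
    factors of [n!] share one index set. *)
Lemma ln_logn m n : (0 < m <= n)%N ->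
  ln (INR m) = \big[Rplus/0]_(0 <= p < n.+1 | prime p) (INR (logn p m) * ln (INR p)).
Proof.
move=> /andP[m0 mn].
rewrite -{1}(partnT m0) (widen_partn predT mn) big_mkcond ln_prod /=; last first.
  by case=> [|i] //= _; rewrite expn_gt0.
rewrite [RHS]big_mkcond; apply: eq_bigr => p _.
case: ifP => [pp|/negbT npp]; last by rewrite lognE (negbTE npp) /= ln_1.
by rewrite ln_expn // prime_gt0.
Qed.

Lemma ln_fact_logn n :
  ln (INR n`!) =
    \big[Rplus/0]_(0 <= p < n.+1 | prime p) (INR (logn p n`!) * ln (INR p)).
Proof.
suff H k : (k <= n)%N -> ln (INR k`!) =
    \big[Rplus/0]_(0 <= p < n.+1 | prime p) (INR (logn p k`!) * ln (INR p)).
  exact: H.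
elim: k => [|k IH] kn.
  by rewrite fact0 ln_1 big1 // => p _; rewrite logn1 Rmult_0_l.
rewrite factS mult_INR ln_mult; try by apply: lt_0_INR; have := fact_gt0 k; lia.
rewrite (@ln_logn k.+1 n) // IH; last by lia.
rewrite -big_split /=; apply: eq_bigr => p _.
by rewrite lognM ?fact_gt0 // plus_INR Rmult_plus_distr_r.
Qed.

(** Legendre's formula. Keeping the leftover term [n %/ p ^ m] makes the induction on the number of
    summands telescope, since [p * (x %/ p) <= x]. *)
Lemma logn_fact_le p n : prime p -> (logn p n`! * p.-1 <= n)%N.
Proof.
move=> pp; have p0 := prime_gt0 pp; rewrite logn_fact //.
suff H m : ((\sum_(1 <= k < m.+1) n %/ p ^ k) * p.-1 + n %/ p ^ m <= n)%N.
  exact: leq_trans (leq_addr _ _) (H n).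
elim: m => [|m IH]; first by rewrite big_geq // expn0 divn1.
rewrite big_nat_recr //= mulnDl expnSr divnMA.
by have := leq_trunc_div (n %/ p ^ m) p; nia.
Qed.

Lemma logn_fact_ge p n : prime p -> (n %/ p <= logn p n`!)%N.
Proof.
move=> pp; rewrite logn_fact //; case: n => [|n]; first by rewrite div0n.
by rewrite big_nat_recl // expn1 leq_addr.
Qed.

Lemma ln_fact_ge n : INR n * ln (INR n) - INR n <= ln (INR n`!).
Proof.
elim: n => [|n IH]; first by rewrite /= ln_1; lra.
have n1 : 0 < INR n.+1 by apply: lt_0_INR; lia.
rewrite factS mult_INR ln_mult //; last by apply: lt_0_INR; have := fact_gt0 n; lia.
case: n IH n1 => [|n] IH n1; first by rewrite /= ln_1; lra.
have n0 : 0 < INR n.+1 by apply: lt_0_INR; lia.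
(* The induction step of this weak Stirling bound amounts to m ln((m + 1) / m) <= 1. *)
suff : INR n.+1 * (ln (INR n.+2) - ln (INR n.+1)) <= 1.
  by move: IH; rewrite [INR n.+2]S_INR; lra.
rewrite -ln_div //; apply: Rle_trans.
  apply: Rmult_le_compat_l; first lra.
  by apply: ln_le_sub1; apply: Rdiv_lt_0_compat.
by rewrite [INR n.+2]S_INR; right; field; lra.
Qed.

Lemma ln_fact_le n : ln (INR n`!) <= INR n * ln (INR n).
Proof.
case: n => [|n]; first by rewrite /= ln_1; lra.
have -> : INR n.+1 * ln (INR n.+1) = ln (INR (n.+1 ^ n.+1)) by rewrite ln_expn.
apply: ln_le; first by apply: lt_0_INR; have := fact_gt0 n.+1; lia.
apply: le_INR; apply/leP.
suff H k : (k <= n.+1 -> k`! <= n.+1 ^ k)%N by exact: H.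
elim: k => // k IH kn.
by rewrite factS expnS leq_mul // IH //; lia.
Qed.

(** * Chebyshev's bound for the product of the primes up to n *)

Lemma prod_primes_dvd (s : seq nat) m : uniq s -> all prime s ->
  (forall p, p \in s -> p %| m)%N -> (\prod_(p <- s) p %| m)%N.
Proof.
elim: s => [|p s IH] /=; first by rewrite big_nil dvd1n.
case/andP=> ps us /andP[pp ap] H; rewrite big_cons Gauss_dvd.
  by rewrite H ?mem_head // IH // => q qs; apply: H; rewrite in_cons qs orbT.
rewrite prime_coprime // Euclid_dvd_prod // big_has.
apply/hasPn => q qs; rewrite dvdn_prime2 //; last exact: (allP ap).
by apply: contraNN ps => /eqP ->.
Qed.

(** The two equal middle coefficients both occur in the binomial expansion of 2^(2m+1) = 2 * 4^m. *)
Lemma bin_odd_le m : ('C(m.*2.+1, m) <= 4 ^ m)%N.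
Proof.
have := expnDn 1 1 m.*2.+1.
have -> : ((1 + 1) ^ m.*2.+1 = 2 * 4 ^ m)%N by rewrite expnS -mul2n expnM.
rewrite (eq_bigr (fun i : 'I__ => 'C(m.*2.+1, i))) => [|i _]; last first.
  by rewrite !exp1n !muln1.
have m1 : (m < m.*2.+2)%N by lia.
have m2 : (m.+1 < m.*2.+2)%N by lia.
rewrite (bigD1 (Ordinal m1)) //= (bigD1 (Ordinal m2)) /=; last first.
  by apply/eqP => /(congr1 val) /=; lia.
have -> : 'C(m.*2.+1, m.+1) = 'C(m.*2.+1, m).
  by rewrite -[RHS]bin_sub; [congr binomial; lia|lia].
lia.
Qed.

Lemma prime_dvd_fact p n : prime p -> (p %| n`! = (p <= n))%N.
Proof.
move=> pp; elim: n => [|n IH].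
  by rewrite fact0 Euclid_dvd1 // leqn0; case: p pp.
rewrite factS Euclid_dvdM // IH [in RHS]leq_eqVlt ltnS.
apply/orP/orP => [[/dvdn_leq|]|[/eqP->|]]; first 1 last; try by right.
  by left.
by move=> /(_ isT); rewrite leq_eqVlt => /orP.
Qed.

(** Erdős's argument by strong induction. An even n > 2 is not prime, so n - 1 gives the same
    product. For n = 2m + 1, the primes up to m + 1 contribute at most 4^(m+1) by induction, and the
    product of those above divides C(2m+1, m) <= 4^m. *)
Lemma prod_primes_le n : (\prod_(0 <= p < n.+1 | prime p) p <= 4 ^ n)%N.
Proof.
elim/ltn_ind: n => n IH.
have [n2|n2] := leqP n 2.
  by case: n n2 {IH} => [|[|[|]]] //= _; rewrite !big_mkcond unlock.
case: (boolP (odd n)) => [on|en]; last first.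
  rewrite big_mkcond big_nat_recr //= -big_mkcond /=.
  have -> : prime n = false.
    by apply/negbTE; apply/negP => /even_prime[]; [lia|move=> H; rewrite H in en].
  rewrite muln1; have := IH n.-1 ltac:(lia); rewrite prednK; last lia.
  by move=> H; apply: leq_trans H _; rewrite leq_exp2l //; lia.
have [m nE] : exists m, n = m.*2.+1 by exists n./2; lia.
subst n; rewrite (@big_cat_nat _ _ _ m.+2) //=; last lia.
have -> : (4 ^ m.*2.+1 = 4 ^ m.+1 * 4 ^ m)%N by rewrite -expnD; congr (_ ^ _)%N; lia.
apply: leq_mul; first by apply: IH; lia.
apply: leq_trans (bin_odd_le m); apply: dvdn_leq; first by rewrite bin_gt0; lia.
rewrite -big_filter; apply: prod_primes_dvd.
- by rewrite filter_uniq // iota_uniq.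
- by rewrite filter_all.
move=> p; rewrite mem_filter mem_index_iota => /andP[pp /andP[mp pm]].
(* The prime divides (2m+1)! = C(2m+1, m) m! (m+1)!, but exceeds m + 1 and so divides neither
   factorial on the right. *)
have : (p %| (m.*2.+1)`!)%N by apply: dvdn_fact; lia.
rewrite -(@bin_fact _ m); last lia.
by rewrite !Euclid_dvdM // !prime_dvd_fact // => /or3P[]//; lia.
Qed.

(** * Sums over primes and the two halves of Mertens' estimate *)

Definition prime_sum (F : nat -> R) (n : nat) : R :=
  \big[Rplus/0]_(0 <= p < n | prime p) F p.

Lemma prime_sumS F n :
  prime_sum F n.+1 = prime_sum F n + if prime n then F n else 0.
Proof. by rewrite /prime_sum big_mkcond big_nat_recr //= -big_mkcond. Qed.

Lemma INR_prime_gt1 p : prime p -> 1 < INR p.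
Proof. by move=> /prime_gt1 /ltP /lt_INR. Qed.

Lemma prime_sum_ln_le n : prime_sum (fun p => ln (INR p)) n.+1 <= INR n * ln 4.
Proof.
rewrite /prime_sum -ln_prod => [|p /prime_gt0 //].
have -> : INR n * ln 4 = ln (INR (4 ^ n)) by rewrite ln_expn //=; congr (_ * ln _); lra.
apply: ln_le; last by apply: le_INR; apply/leP; exact: prod_primes_le.
apply: lt_0_INR; apply/ltP; rewrite big_seq_cond.
by apply: prodn_cond_gt0 => p /andP[_ /prime_gt0].
Qed.

(** With N = n + 1, compare N ln N - N <= ln N! with ln N! = sum of v_p(N!) ln p, where v_p(N!) <= N
    / (p - 1). *)
Lemma mertens_lower n :
  ln (INR n.+1) - 1 <= prime_sum (fun p => ln (INR p) / (INR p - 1)) n.+2.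
Proof.
have n0 : 0 < INR n.+1 by apply: lt_0_INR; lia.
apply: (Rmult_le_reg_l (INR n.+1)) => //.
apply: Rle_trans (_ : _ <= ln (INR (n.+1)`!)) _.
  by have := ln_fact_ge n.+1; lra.
rewrite ln_fact_logn /prime_sum -Rsum_mull; apply: Rsum_le => p pp.
have p1 := INR_prime_gt1 pp.
have -> : INR n.+1 * (ln (INR p) / (INR p - 1)) = INR n.+1 / (INR p - 1) * ln (INR p).
  by field; lra.
apply: Rmult_le_compat_r; first exact: ln_nat_ge0.
apply: (Rmult_le_reg_r (INR p - 1)); first lra.
rewrite /Rdiv Rmult_assoc Rinv_l ?Rmult_1_r; last lra.
have -> : INR p - 1 = INR p.-1.
  by rewrite -[in LHS](prednK (prime_gt0 pp)) S_INR; lra.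
by rewrite -mult_INR; apply: le_INR; apply/leP; exact: logn_fact_le.
Qed.

(** With N = n + 1, the bound N / p <= v_p(N!) + 1 and ln N! <= N ln N give the main term; the
    rounding error 1 in each exponent costs the sum of ln p, at most N ln 4 by Chebyshev. *)
Lemma mertens_upper n :
  prime_sum (fun p => ln (INR p) / INR p) n.+2 <= ln (INR n.+1) + ln 4.
Proof.
have n0 : 0 < INR n.+1 by apply: lt_0_INR; lia.
apply: (Rmult_le_reg_l (INR n.+1)) => //.
suff : INR n.+1 * prime_sum (fun p => ln (INR p) / INR p) n.+2 <=
    ln (INR (n.+1)`!) + prime_sum (fun p => ln (INR p)) n.+2.
  by have := ln_fact_le n.+1; have := prime_sum_ln_le n.+1; lra.
rewrite ln_fact_logn /prime_sum -Rsum_mull -big_split /=; apply: Rsum_le => p pp.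
have p1 := INR_prime_gt1 pp.
have -> : INR n.+1 * (ln (INR p) / INR p) = INR n.+1 / INR p * ln (INR p).
  by field; lra.
suff : INR n.+1 / INR p * ln (INR p) <= (INR (logn p (n.+1)`!) + 1) * ln (INR p).
  by lra.
apply: Rmult_le_compat_r; first exact: ln_nat_ge0.
apply: (Rmult_le_reg_r (INR p)); first lra.
rewrite /Rdiv Rmult_assoc Rinv_l ?Rmult_1_r; last lra.
rewrite -S_INR -mult_INR; apply: le_INR; apply/leP.
by have := logn_fact_ge n.+1 pp; have := ltn_ceil n.+1 (prime_gt0 pp); nia.
Qed.

(* From [n] to [n + 1], [(ln (n + 1) + 2) / (n + 1)] drops by at least the new
   term of the sum. *)
Lemma prime_sum_ln_div_sqr_le n :
  prime_sum (fun p => ln (INR p) / (INR p * (INR p - 1))) n.+2 <=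
    2 - (ln (INR n.+1) + 2) / INR n.+1.
Proof.
elim: n => [|n IH].
  by rewrite /prime_sum big_mkcond unlock /= ln_1; lra.
have m0 : 0 < INR n.+1 by apply: lt_0_INR; lia.
have M0 : 0 < INR n.+2 by apply: lt_0_INR; lia.
have ME : INR n.+2 = INR n.+1 + 1 by rewrite S_INR.
have m1 : 1 <= INR n.+1 by rewrite S_INR; have := pos_INR n; lra.
suff step : ln (INR n.+2) / (INR n.+2 * (INR n.+2 - 1)) <=
    (ln (INR n.+1) + 2) / INR n.+1 - (ln (INR n.+2) + 2) / INR n.+2.
  have term0 : 0 <= ln (INR n.+2) / (INR n.+2 * (INR n.+2 - 1)).
    apply: Rmult_le_pos; first exact: ln_nat_ge0.
    by apply/Rlt_le/Rinv_0_lt_compat/Rmult_lt_0_compat; lra.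
  by rewrite prime_sumS; case: ifP => _; lra.
apply: (Rmult_le_reg_r (INR n.+2 * INR n.+1)); first exact: Rmult_lt_0_compat.
rewrite (_ : INR n.+2 - 1 = INR n.+1); last lra.
have -> : ln (INR n.+2) / (INR n.+2 * INR n.+1) * (INR n.+2 * INR n.+1) = ln (INR n.+2).
  by field; lra.
have -> : ((ln (INR n.+1) + 2) / INR n.+1 - (ln (INR n.+2) + 2) / INR n.+2)
    * (INR n.+2 * INR n.+1) =
    INR n.+2 * (ln (INR n.+1) + 2) - INR n.+1 * (ln (INR n.+2) + 2) by field; lra.
suff : INR n.+2 * (ln (INR n.+2) - ln (INR n.+1)) <= 2 by rewrite ME; lra.
rewrite -ln_div //; apply: Rle_trans.
  apply: Rmult_le_compat_l; first lra.
  by apply: ln_le_sub1; apply: Rdiv_lt_0_compat.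
rewrite ME (_ : (INR n.+1 + 1) * ((INR n.+1 + 1) / INR n.+1 - 1) = 1 + / INR n.+1).
  by have := Rinv_le_contravar 1 _ Rlt_0_1 m1; rewrite Rinv_1; lra.
by field; lra.
Qed.

(** The weight is ln p / (p - 1), the increment of h_r, so the upper half goes through 1/(p - 1) =
    1/p + 1/(p (p - 1)), whose second part contributes a bounded sum. *)
Lemma mertens_first : exists C, forall n,
  Rabs (prime_sum (fun p => ln (INR p) / (INR p - 1)) n.+2 - ln (INR n.+1)) <= C.
Proof.
exists (ln 4 + 3) => n; apply: Rabs_le.
have l4 : 0 <= ln 4 by rewrite -ln_1; apply: ln_le; lra.
split; first by have := mertens_lower n; lra.
suff -> : prime_sum (fun p => ln (INR p) / (INR p - 1)) n.+2 =
    prime_sum (fun p => ln (INR p) / INR p) n.+2 +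
    prime_sum (fun p => ln (INR p) / (INR p * (INR p - 1))) n.+2.
  have := mertens_upper n; have := prime_sum_ln_div_sqr_le n.
  suff : 0 <= (ln (INR n.+1) + 2) / INR n.+1 by lra.
  apply: Rmult_le_pos; first by have := ln_nat_ge0 n.+1; lra.
  by apply/Rlt_le/Rinv_0_lt_compat/lt_0_INR; lia.
rewrite /prime_sum -big_split /=; apply: eq_bigr => p pp.
by have := INR_prime_gt1 pp; move=> ?; field; lra.
Qed.

(** * The sequence of primes *)

Lemma next_primeP m :
  [/\ (m < next_prime m)%N, prime (next_prime m) &
      forall q, prime q -> (m < q)%N -> (next_prime m <= q)%N].
Proof.
rewrite /next_prime; case: ex_minnP => p /andP[mp pp] pmin.
by split=> // q pq mq; apply: pmin; rewrite mq.
Qed.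

Lemma prime_nth_prime r : prime (nth_prime r).
Proof. by case: r => // r; case: (next_primeP (nth_prime r)). Qed.

Lemma nth_prime_ltS r : (nth_prime r < nth_prime r.+1)%N.
Proof. by case: (next_primeP (nth_prime r)). Qed.

Lemma nth_prime_mono i r : (i < r)%N -> (nth_prime i < nth_prime r)%N.
Proof.
elim: r => // r IH; rewrite ltnS leq_eqVlt => /orP[/eqP->|/IH H].
  exact: nth_prime_ltS.
exact: ltn_trans H (nth_prime_ltS r).
Qed.

Lemma nth_prime_gt r : (r < nth_prime r)%N.
Proof. by elim: r => // r IH; apply: leq_ltn_trans IH (nth_prime_ltS r). Qed.

Lemma prime_sum_nth_primeS F r :
  prime_sum F (nth_prime r.+1) = prime_sum F (nth_prime r) + F (nth_prime r).
Proof.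
have [lt_r _ min_r] := next_primeP (nth_prime r).
have -> : prime_sum F (nth_prime r) + F (nth_prime r) = prime_sum F (nth_prime r).+1.
  by rewrite prime_sumS prime_nth_prime.
rewrite /prime_sum (@big_cat_nat _ _ _ (nth_prime r).+1) //=.
rewrite [X in _ + X]big_nat_cond [X in _ + X]big1 ?Rplus_0_r // => q.
move=> /andP[/andP[rq qr] pq].
by have := min_r q pq rq; rewrite leqNgt -/(nth_prime r.+1) qr.
Qed.

Lemma primorialS r : primorial r.+1 = (primorial r * nth_prime r)%N.
Proof.
have iotaSr : iota 0 r.+1 = iota 0 r ++ [:: r] by rewrite -addn1 iotaD.
rewrite /primorial /first_primes /mkseq iotaSr map_cat big_cat /=.
by rewrite big_cons big_nil muln1.
Qed.

Lemma coprime_nth_prime_primorial r : coprime (nth_prime r) (primorial r).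
Proof.
have pr := prime_nth_prime r.
rewrite prime_coprime // /primorial Euclid_dvd_prod // big_has.
apply/hasPn => q /mapP[i]; rewrite mem_iota /= => ir ->.
rewrite dvdn_prime2 ?prime_nth_prime //; apply/eqP => E.
by have := nth_prime_mono ir; rewrite E ltnn.
Qed.

Lemma primorial_gt0 r : (0 < primorial r)%N.
Proof.
elim: r => [|r IH]; first by rewrite /primorial big_nil.
by rewrite primorialS muln_gt0 IH prime_gt0 // prime_nth_prime.
Qed.

Lemma totient_primorialS r :
  totient (primorial r.+1) = (totient (primorial r) * (nth_prime r).-1)%N.
Proof.
rewrite primorialS totient_coprime ?(totient_prime (prime_nth_prime r)) //.
by rewrite coprime_sym coprime_nth_prime_primorial.
Qed.

(** * Second-order expansions at 0+ *)

Definition bounded_near0 (u : R -> R) : Prop :=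
  exists e K, 0 < e /\ forall t, 0 < t < e -> Rabs (u t) <= K.

Lemma bounded_near0_ext (u v : R -> R) :
  (forall t, 0 < t -> u t = v t) -> bounded_near0 u -> bounded_near0 v.
Proof.
move=> uv [e [K [e0 H]]]; exists e, K; split=> // t te.
by rewrite -uv; [apply: H|lra].
Qed.

Lemma bounded_near0_const c : bounded_near0 (fun=> c).
Proof. by exists 1, (Rabs c); split=> [|t _]; lra. Qed.

Lemma bounded_near0_id : bounded_near0 id.
Proof. by exists 1, 1; split=> [|t t01]; [lra|apply: Rabs_le; lra]. Qed.

Lemma bounded_near0_add u v :
  bounded_near0 u -> bounded_near0 v -> bounded_near0 (fun t => u t + v t).
Proof.
move=> [e [K [e0 H]]] [e' [K' [e'0 H']]]; exists (Rmin e e'), (K + K').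
split=> [|t [t0 /Rmin_Rgt [te te']]]; first exact: Rmin_glb_lt.
apply: Rle_trans (Rabs_triang _ _) _.
by apply: Rplus_le_compat; [apply: H|apply: H'].
Qed.

Lemma bounded_near0_mul u v :
  bounded_near0 u -> bounded_near0 v -> bounded_near0 (fun t => u t * v t).
Proof.
move=> [e [K [e0 H]]] [e' [K' [e'0 H']]]; exists (Rmin e e'), (K * K').
split=> [|t [t0 /Rmin_Rgt [te te']]]; first exact: Rmin_glb_lt.
rewrite Rabs_mult.
by apply: Rmult_le_compat; try exact: Rabs_pos; [apply: H|apply: H'].
Qed.

Lemma bounded_near0_div_id x : bounded_near0 (fun t => x / t) -> x = 0.
Proof.
move=> [e [K [e0 H]]]; case: (Req_dec x 0) => // x0; exfalso.
have xp := Rabs_pos_lt _ x0.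
have K0 : 0 <= K by apply: Rle_trans (Rabs_pos _) (H (e / 2) _); lra.
(* For this t, boundedness gives |x| <= K t, while (K + 1) t <= |x| / 2: impossible when x is
   nonzero. *)
pose t := Rmin (e / 2) (Rabs x / (K + 1) / 2).
have q0 : 0 < Rabs x / (K + 1) by apply: Rdiv_lt_0_compat; lra.
have t0 : 0 < t by apply: Rmin_glb_lt; lra.
have te : t <= e / 2 by apply: Rmin_l.
have tx : t <= Rabs x / (K + 1) / 2 by apply: Rmin_r.
have := H t ltac:(lra); rewrite Rabs_div; last lra.
rewrite (Rabs_pos_eq t); last lra.
move=> /(Rmult_le_compat_r t _ _ (Rlt_le _ _ t0)).
rewrite (_ : Rabs x / t * t = Rabs x); last by field; lra.
have : (K + 1) * t <= Rabs x / 2.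
  apply: Rle_trans (Rmult_le_compat_l (K + 1) _ _ ltac:(lra) tx) _.
  by right; field; lra.
by lra.
Qed.

(** This is f(t) = a + b t + c t^2 + O(t^3) as t -> 0+. It is one-sided because the Dirichlet series
    is only available for t > 0. *)
Definition expands2 (f : R -> R) (a b c : R) : Prop :=
  bounded_near0 (fun t => (f t - (a + b * t + c * t ^ 2)) / t ^ 3).

Lemma expands2_ext (f g : R -> R) a b c :
  (forall t, 0 < t -> f t = g t) -> expands2 f a b c -> expands2 g a b c.
Proof. by move=> fg; apply: bounded_near0_ext => t t0; rewrite fg. Qed.

Lemma expands2_addl k f a b c :
  expands2 f a b c -> expands2 (fun t => k + f t) (k + a) b c.
Proof. by apply: bounded_near0_ext => t t0; congr (_ / _); ring. Qed.

(** Serves to clear the simple pole at s = 1: [k] is the residue and [f] the regular part. The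
    coefficient [c] moves into the remainder. *)
Lemma expands2_mulX k f a b c :
  expands2 f a b c -> expands2 (fun t => k + t * f t) k a b.
Proof.
move=> /(bounded_near0_mul bounded_near0_id).
move=> /(bounded_near0_add (bounded_near0_const c)).
by apply: bounded_near0_ext => t t0; rewrite /id; field; lra.
Qed.

Lemma expands2_mul f g a b c a' b' c' :
  expands2 f a b c -> expands2 g a' b' c' ->
  expands2 (fun t => f t * g t) (a * a') (a * b' + b * a') (a * c' + b * b' + c * a').
Proof.
have Bc := bounded_near0_const; have Bx := bounded_near0_id.
have B3 : bounded_near0 (fun t => t * (t * t)) by do !apply: bounded_near0_mul.
have BP x y z : bounded_near0 (fun t => x + y * t + z * (t * t)).
  by do !apply: bounded_near0_add => //; do !apply: bounded_near0_mul.
move=> Bf Bg.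
(* The first summand collects the t^3 and t^4 terms of the product of the two quadratics, divided by
   t^3; the others carry the remainders of [f] and [g]. *)
apply: bounded_near0_ext (bounded_near0_add (bounded_near0_add
  (BP (b * c' + c * b') (c * c') 0) (bounded_near0_mul (BP a b c) Bg))
  (bounded_near0_add (bounded_near0_mul (BP a' b' c') Bf)
    (bounded_near0_mul B3 (bounded_near0_mul Bf Bg)))) => t t0.
by field; lra.
Qed.

Lemma expands2_unique f a b c a' b' c' :
  expands2 f a b c -> expands2 f a' b' c' -> [/\ a = a', b = b' & c = c'].
Proof.
have Bc := bounded_near0_const; have Bx := bounded_near0_id.
move=> Bf /(bounded_near0_mul (Bc (-1))) /(bounded_near0_add Bf) BD {Bf}.
(* [BD] bounds the difference of the two quadratics over t^3. Multiplied by t^2, by t and by 1, it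
   isolates the constant, linear and quadratic coefficients in turn. *)
have BxD := bounded_near0_mul Bx BD; have BxxD := bounded_near0_mul Bx BxD.
have ea : a' - a = 0.
  apply: bounded_near0_div_id.
  apply: bounded_near0_ext (bounded_near0_add BxxD (bounded_near0_add
    (Bc (b - b')) (bounded_near0_mul (Bc (c - c')) Bx))) => t t0.
  by rewrite /id; field; lra.
have eb : b' - b = 0.
  apply: bounded_near0_div_id.
  apply: bounded_near0_ext (bounded_near0_add BxD (Bc (c - c'))) => t t0.
  by rewrite /id (_ : a' = a); [field|]; lra.
have ec : c' - c = 0.
  apply: bounded_near0_div_id; apply: bounded_near0_ext BD => t t0.
  by rewrite (_ : a' = a) 1?(_ : b' = b); [field| |]; lra.
by split; lra.
Qed.

Lemma CV_radius_ge_ex_pseries (a : nat -> R) x :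
  ex_pseries a x -> Rbar_le (Rabs x) (CV_radius a).
Proof.
move=> ax; apply: Rbar_not_lt_le => /CV_disk_outside; apply.
by apply: ex_series_lim_0; apply/ex_pseries_R.
Qed.

(** The remainder over t^3 is the power series with the first three coefficients dropped. It has the
    same positive radius of convergence, so it is continuous at 0 and hence bounded nearby. *)
Lemma expands2_pseries (a : nat -> R) (f : R -> R) e : 0 < e ->
  (forall t, 0 < t < e -> is_pseries a t (f t)) -> expands2 f (a 0%N) (a 1%N) (a 2%N).
Proof.
move=> e0 H.
have rad : Rbar_lt (Rabs 0) (CV_radius (PS_decr_n a 3)).
  have -> : CV_radius (PS_decr_n a 3) = CV_radius a.
    by rewrite -(CV_radius_decr_1 a) -(CV_radius_decr_1 (PS_decr_1 a))
      -(CV_radius_decr_1 (PS_decr_1 (PS_decr_1 a))).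
  have h : 0 < e / 2 < e by lra.
  apply: (Rbar_lt_le_trans _ (Rabs (e / 2))).
    by rewrite /= Rabs_R0; apply: Rabs_pos_lt; lra.
  by apply: CV_radius_ge_ex_pseries; exists (f (e / 2)); apply: H.
have /continuity_pt_locally /(_ (mkposreal 1 Rlt_0_1)) [d Hd] := PSeries_continuity _ _ rad.
exists (Rmin d e), (Rabs (PSeries (PS_decr_n a 3) 0) + 1).
split=> [|t [t0 /Rmin_Rgt [td te]]]; first by apply: Rmin_glb_lt => //; apply: cond_pos.
have Ht := H t (conj t0 te).
have tE := PSeries_decr_n a 2 t (ex_intro _ _ Ht).
rewrite (is_pseries_unique _ _ _ Ht) in tE.
rewrite tE /= (_ : _ / _ = PSeries (PS_decr_n a 3) t); last by field; lra.
have /Hd /= : ball 0 d t.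
  by rewrite /ball /= /AbsRing_ball /abs /minus /plus /opp /= Rabs_pos_eq; lra.
set x := PSeries _ t; set y := PSeries _ 0 => xy.
have := Rabs_triang (x - y) y; rewrite (_ : x - y + y = x); last ring.
by lra.
Qed.

(** The factor 1 - p^(-s) at s = 1 + t, expanded through p^(-1-t) = p^(-1) exp(-t ln p). *)
Lemma expands2_euler_factor p : 0 < p ->
  expands2 (fun t => 1 - exp (- ((1 + t) * ln p)))
    (1 - / p) (ln p / p) (- (ln p ^ 2 / (2 * p))).
Proof.
move=> p0; pose a n := - / p * ((- ln p) ^ n / INR (Factorial.fact n)).
have ps t : is_pseries a t (- exp (- ((1 + t) * ln p))).
  have -> : - exp (- ((1 + t) * ln p)) = - / p * exp (- (t * ln p)).
    rewrite (_ : - ((1 + t) * ln p) = - ln p + - (t * ln p)); last ring.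
    by rewrite exp_plus exp_Ropp exp_ln //; ring.
  apply/is_pseries_R.
  have /is_pseries_R /(is_series_scal (- / p)) := is_exp_Reals (- (t * ln p)).
  apply: is_series_ext => n; rewrite /scal /= /mult /= /a.
  rewrite (_ : - (t * ln p) = - ln p * t); last ring.
  by rewrite Rpow_mult_distr /Rdiv; ring.
have := expands2_addl 1 (expands2_pseries Rlt_0_1 (fun t _ => ps t)).
rewrite (_ : 1 + a 0%N = 1 - / p); last by rewrite /a /=; field; lra.
rewrite (_ : a 1%N = ln p / p); last by rewrite /a /=; field; lra.
by rewrite (_ : a 2%N = - (ln p ^ 2 / (2 * p))); last by rewrite /a /=; field; lra.
Qed.

(** * The recurrence for the Laurent coefficients *)

Lemma is_series_Re (u : nat -> C) (l : C) :
  is_series (K := C_AbsRing) (V := C_NormedModule) u l ->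
  is_series (fun n => Re (u n)) (Re l).
Proof.
move=> ul; have E n : sum_n (fun n => Re (u n)) n = Re (sum_n u n).
  by elim: n => [|n IH]; rewrite ?sum_O // !sum_Sn IH.
apply: (filterlim_ext (fun n => Re (sum_n u n))) => [n|]; first by rewrite E.
apply: filterlim_comp ul _.
by case: l => x y; apply: continuous_fst.
Qed.

Definition partial_sum (F : nat -> R) (n : nat) : R :=
  \big[Rplus/0]_(1 <= m < n.+1) F m.

Lemma partial_sumS F n : partial_sum F n.+1 = partial_sum F n + F n.+1.
Proof. by rewrite /partial_sum big_nat_recr. Qed.

Lemma is_series_partial_sum (F : nat -> R) (l : R) :
  is_series (fun n => F n.+1) l <-> is_lim_seq (partial_sum F) l.
Proof.
rewrite is_lim_seq_incr_1.
have E n : sum_n (fun n => F n.+1) n = partial_sum F n.+1.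
  elim: n => [|n IH]; last by rewrite sum_Sn IH [RHS]partial_sumS.
  by rewrite sum_O /partial_sum big_nat1.
split=> [Fl|]; first exact: (is_lim_seq_ext _ _ (Rbar.Finite l) E Fl).
exact: (is_lim_seq_ext _ _ (Rbar.Finite l) (fun n => esym (E n))).
Qed.

(** The partial sum up to n of the spread-out series is the original partial sum up to [n %/ p]. *)
Lemma is_series_multiples (F : nat -> R) (l : R) p : (0 < p)%N ->
  is_series (fun n => F n.+1) l ->
  is_series (fun n => if (p %| n.+1)%N then F (n.+1 %/ p)%N else 0) l.
Proof.
move=> p0 /is_series_partial_sum Fl.
apply/(is_series_partial_sum (fun n => if (p %| n)%N then F (n %/ p)%N else 0)).
apply: (is_lim_seq_ext (fun n => partial_sum F (n %/ p)%N)) => [n|].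
  elim: n => [|n IH]; first by rewrite div0n /partial_sum !big_geq.
  rewrite partial_sumS -IH divnS //; case: (p %| n.+1)%N => /=.
    by rewrite add1n partial_sumS.
  by rewrite Rplus_0_r.
apply: is_lim_seq_subseq Fl => P [N HN]; exists (N * p)%N => n /leP Nn.
by apply: HN; apply/leP; rewrite leq_divRL.
Qed.

(** The n-th term of L(s, chi_0) at the real point s = 1 + t. *)
Definition real_dirichlet (q : nat) (t : R) (n : nat) : R :=
  (if coprime n q then 1 else 0) * exp (- ((1 + t) * ln (INR n))).

Lemma real_dirichletM q t p m : coprime p q -> (0 < p)%N -> (0 < m)%N ->
  real_dirichlet q t (p * m) = exp (- ((1 + t) * ln (INR p))) * real_dirichlet q t m.
Proof.
move=> pq p0 m0; rewrite /real_dirichlet coprimeMl pq /= mult_INR.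
rewrite ln_mult; try by apply: lt_0_INR; lia.
rewrite Rmult_plus_distr_l Ropp_plus_distr exp_plus.
by case: (coprime m q) => /=; ring.
Qed.

Lemma real_dirichlet_prime q t p n : prime p ->
  real_dirichlet (q * p) t n =
    real_dirichlet q t n - if (p %| n)%N then real_dirichlet q t n else 0.
Proof.
move=> pp; rewrite /real_dirichlet coprimeMr [coprime n p]coprime_sym.
rewrite (prime_coprime n pp); case: (coprime n q); case: (p %| n)%N => /=; ring.
Qed.

(** Passing from modulus q to q p deletes the terms at multiples of p; by multiplicativity these sum
    to p^(-s) times the whole series. *)
Lemma is_series_euler_factor q t p l : prime p -> coprime p q ->
  is_series (fun n => real_dirichlet q t n.+1) l ->
  is_series (fun n => real_dirichlet (q * p) t n.+1)
    ((1 - exp (- ((1 + t) * ln (INR p)))) * l).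
Proof.
move=> pp pq ql; set e := exp _.
have := is_series_minus _ _ _ _ ql
  (is_series_scal e _ _ (is_series_multiples (prime_gt0 pp) ql)).
rewrite (_ : plus l _ = (1 - e) * l); last first.
  by rewrite /plus /opp /scal /= /mult /=; ring.
apply: is_series_ext => n; rewrite real_dirichlet_prime //.
rewrite /plus /opp /scal /= /mult /= /Rminus; congr (_ + - _).
case: ifP => [/dvdnP[m E]|_]; last by ring.
have m0 : (0 < m)%N by case: m E.
by rewrite E mulnK ?prime_gt0 // mulnC (real_dirichletM _ pq (prime_gt0 pp) m0).
Qed.

Lemma pow_n_RtoC t k : pow_n (K := C_AbsRing) (RtoC t) k = RtoC (t ^ k).
Proof. by elim: k => // k IH; rewrite /= IH /mult /= -RtoC_mult. Qed.

Lemma principal_L_real q L t : is_principal_L q L -> 0 < t ->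
  is_series (fun n => real_dirichlet q t n.+1) (Re (L (RtoC (1 + t)))).
Proof.
move=> [H _] t0; have := H (RtoC (1 + t)) ltac:(by rewrite /=; lra).
move=> /is_series_Re; apply: is_series_ext => n.
rewrite /principal_char /npow_opp -RtoC_mult -RtoC_opp /Cexp /real_dirichlet /=.
by rewrite cos_0; case: ifP => _ /=; ring.
Qed.

Lemma INR_nth_prime_ge2 r : 2 <= INR (nth_prime r).
Proof. by apply: (le_INR 2); apply/leP; exact/prime_gt1/prime_nth_prime. Qed.

(** A_r, the residue of L(s, chi_0) at s = 1. *)
Definition density (r : nat) : R :=
  INR (totient (primorial r)) / INR (primorial r).

Lemma density_gt0 r : 0 < density r.
Proof.
by apply: Rdiv_lt_0_compat; apply: lt_0_INR; apply/ltP;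
  rewrite ?totient_gt0 primorial_gt0.
Qed.

Lemma densityS r : density r.+1 = density r * (1 - / INR (nth_prime r)).
Proof.
have p2 := INR_nth_prime_ge2 r.
have q0 : 0 < INR (primorial r) by apply: lt_0_INR; apply/ltP/primorial_gt0.
rewrite /density totient_primorialS primorialS !mult_INR.
have -> : INR (nth_prime r).-1 = INR (nth_prime r) - 1.
  by rewrite -[in RHS](prednK (prime_gt0 (prime_nth_prime r))) S_INR; ring.
by field; lra.
Qed.

(** The Laurent expansion along s = 1 + t, multiplied by t. All coefficients are real, so real parts
    retain them; the sign of [g 1] comes from (-1)^k. *)
Lemma gamma_expansion r g : is_gamma r g ->
  exists2 L, is_principal_L (primorial r) L &
    expands2 (fun t => t * Re (L (RtoC (1 + t)))) (density r) (g 0%N) (- g 1%N).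
Proof.
move=> [L [HL [eps H]]]; exists L => //.
have q0 : 0 < INR (primorial r) by apply: lt_0_INR; apply/ltP/primorial_gt0.
pose c k := (-1) ^ k * g k / INR (k`!).
have ps t : 0 < t < eps -> is_pseries c t (Re (L (RtoC (1 + t))) - density r / t).
  move=> [t0 te].
  have sE : (RtoC (1 + t) - RtoC 1)%C = RtoC t.
    by rewrite -RtoC_minus; congr RtoC; ring.
  have := H (RtoC (1 + t)); rewrite sE Cmod_R Rabs_pos_eq; last lra.
  move=> /(_ (conj t0 te)) /is_series_Re.
  have -> : (RtoC (INR (totient (primorial r))) / (RtoC (INR (primorial r)) * RtoC t))%C =
      RtoC (density r / t).
    rewrite /density /Rdiv Rmult_assoc -Rinv_mult -/(Rdiv _ _) RtoC_div ?RtoC_mult //.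
    by apply: Rgt_not_eq; apply: Rmult_lt_0_compat.
  apply: is_series_ext => k.
  rewrite pow_n_RtoC pow_n_pow.
  by rewrite [LHS]/(Re (RtoC (t ^ k) * RtoC (c k))%C) -RtoC_mult.
have := expands2_mulX (density r) (expands2_pseries (cond_pos eps) ps).
rewrite (_ : c 0%N = g 0%N); last by rewrite /c /=; field.
rewrite (_ : c 1%N = - g 1%N); last by rewrite /c /=; field.
by apply: expands2_ext => t t0; field; lra.
Qed.

(** For t > 0 the two L-functions differ by the Euler factor of p, so multiplying expansions and
    invoking uniqueness lets the coefficients of t and t^2 be compared. *)
Lemma gamma_rec (gamma : nat -> nat -> R) (r : nat) (p := INR (nth_prime r)) :
  (forall r, is_gamma r (gamma r)) ->
  gamma r.+1 0%N = (1 - / p) * gamma r 0%N + density r * (ln p / p) /\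
  gamma r.+1 1%N = (1 - / p) * gamma r 1%N - gamma r 0%N * (ln p / p)
                   + density r * (ln p ^ 2 / (2 * p)).
Proof.
move=> gammaP.
have [L HL X] := gamma_expansion (gammaP r).
have [L' HL' X'] := gamma_expansion (gammaP r.+1).
have p0 : 0 < p by have := INR_prime_gt1 (prime_nth_prime r); rewrite -/p; lra.
have := expands2_mul (expands2_euler_factor p0) X.
have E t : 0 < t -> (1 - exp (- ((1 + t) * ln p))) * (t * Re (L (RtoC (1 + t)))) =
    t * Re (L' (RtoC (1 + t))).
  move=> t0.
  have /is_series_unique := principal_L_real HL' t0.
  have := is_series_euler_factor (prime_nth_prime r) (coprime_nth_prime_primorial r)
    (principal_L_real HL t0).
  by rewrite -primorialS => /is_series_unique -> <-; rewrite /p; ring.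
move=> /(expands2_ext E) /(expands2_unique X')[_ -> e1].
split; first by ring.
by rewrite -[LHS]Ropp_involutive e1; ring.
Qed.

(** * Growth of the normalised coefficients *)

(* With [V = h^2 - 2 G] the target inequality reads [(h - l)^2 < V], and [V]
   grows at least like [h / 2]. *)
Lemma eventually_dominated (l a h G : nat -> R) (C : R) :
  (forall r, / 2 <= l r) -> (forall r, 0 < a r) ->
  (forall M, exists r0, forall r, (r0 <= r)%N -> M <= l r) ->
  (forall r, Rabs (h r - l r) <= C) ->
  (forall r, h r.+1 = h r + a r) ->
  (forall r, G r.+1 = G r + a r * (h r - l r / 2)) ->
  exists r0, forall r, (r0 <= r)%N ->
    0 <= G r /\ G r < h r * l r - l r ^ 2 / 2.
Proof.
move=> l_ge a0 l_infty hl hS GS.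
have hC r : l r - C <= h r <= l r + C.
  by move: (hl r) => /Rabs_le_between; lra.
pose V r := h r ^ 2 - 2 * G r.
have VS r : V r.+1 = V r + a r * (a r + l r) by rewrite /V hS GS; field.
(* Since l >= 1/2, each increment a (a + l) of V is at least a / 2, half the increment of h. *)
have V_ge r : V 0%N + (h r - h 0%N) / 2 <= V r.
  elim: r => [|r IH]; first by lra.
  by rewrite VS hS; have := a0 r; have := l_ge r; nra.
(* Past this threshold h - l / 2 >= l / 2 - C >= 1, so G gains at least a, the increment of h, at
   each step. *)
have [r1 Hr1] := l_infty (2 * C + 2).
have G_ge r : (r1 <= r)%N -> G r1 + (h r - h r1) <= G r.
  elim: r => [|r IH]; first by rewrite leqn0 => /eqP ->; lra.
  rewrite leq_eqVlt => /orP[/eqP->|r1r]; first by lra.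
  by rewrite GS hS; have := IH r1r; have := a0 r; have := hC r; have := Hr1 r r1r; nra.
(* Together with h >= l - C, this threshold makes the lower bound on G nonnegative, and the next one
   makes the lower bound on V at least C^2 + 1. *)
have [r2 Hr2] := l_infty (C + h r1 - G r1).
have [r3 Hr3] := l_infty (C + h 0%N + 2 * (C ^ 2 + 1 - V 0%N)).
exists (maxn r1 (maxn r2 r3)) => r; rewrite !geq_max => /and3P[r1r r2r r3r].
split; first by have := G_ge r r1r; have := Hr2 r r2r; have := hC r; lra.
have : C ^ 2 < V r by have := V_ge r; have := Hr3 r r3r; have := hC r; lra.
have : (h r - l r) ^ 2 <= C ^ 2.
  by rewrite -(pow2_abs (h r - l r)); apply: pow_incr; split; [apply: Rabs_pos|].
by rewrite /V; lra.
Qed.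

Lemma ln_nth_prime_infty M :
  exists r0, forall r, (r0 <= r)%N -> M <= ln (INR (nth_prime r)).
Proof.
have [N HN] := INR_unbounded (exp M); exists N => r Nr.
rewrite -(ln_exp M); apply: ln_le; first exact: exp_pos.
apply: Rle_trans (Rlt_le _ _ HN) _; apply: le_INR; apply/leP.
exact: leq_trans Nr (ltnW (nth_prime_gt r)).
Qed.

Lemma prime_sum_nth_prime_bounded : exists C, forall r,
  Rabs (prime_sum (fun p => ln (INR p) / (INR p - 1)) (nth_prime r)
        - ln (INR (nth_prime r))) <= C.
Proof.
(* Mertens' sum includes the prime p_{r+1} itself, while the sum here stops just before it; the
   extra term lies between 0 and 1. *)
have [C HC] := mertens_first; exists (C + 1) => r.
have p2 := INR_nth_prime_ge2 r.
have := HC (nth_prime r).-1; rewrite prednK ?prime_gt0 ?prime_nth_prime //.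
rewrite prime_sumS prime_nth_prime.
set p := INR _ in p2 *; set s := prime_sum _ _ => /Rabs_le_between sC.
have : 0 <= ln p / (p - 1).
  by apply: Rmult_le_pos; [exact: ln_nat_ge0|apply/Rlt_le/Rinv_0_lt_compat; lra].
have : ln p / (p - 1) <= 1.
  apply: (Rmult_le_reg_r (p - 1)); first lra.
  rewrite /Rdiv Rmult_assoc Rinv_l ?Rmult_1_r; last lra.
  by rewrite Rmult_1_l; apply: ln_le_sub1; lra.
by move=> ? ?; apply: Rabs_le; lra.
Qed.

Theorem theorem5 (gamma : nat -> nat -> R)
    (gammaP : forall r : nat, is_gamma r (gamma r)) :
  exists r0 : nat, forall r : nat, (r0 <= r)%N ->
    (Rabs (gamma r.+1 1%N) > Rabs (gamma r 1%N))%R.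
Proof.
pose p r := INR (nth_prime r); pose a r := ln (p r) / (p r - 1).
pose h r := gamma r 0%N / density r; pose G r := - gamma r 1%N / density r.
have p2 : forall r, 2 <= p r := INR_nth_prime_ge2.
have l_ge r : / 2 <= ln (p r).
  by apply: Rle_trans (Rlt_le _ _ ln_lt_2) _; apply: ln_le => //; lra.
have a0 r : 0 < a r.
  by apply: Rdiv_lt_0_compat; have := p2 r; have := l_ge r; lra.
have hS r : h r.+1 = h r + a r.
  rewrite /h densityS (proj1 (gamma_rec r gammaP)) -/(p r) /a.
  by field; have := p2 r; have := density_gt0 r; lra.
have GS r : G r.+1 = G r + a r * (h r - ln (p r) / 2).
  rewrite /G densityS (proj2 (gamma_rec r gammaP)) -/(p r) /a /h.
  by field; have := p2 r; have := density_gt0 r; lra.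
(* Telescoping turns h into a sum over the primes below [nth_prime r], to which Mertens' theorem
   applies; for r = 0 there is no prime below 2. *)
have hE r : h r = h 0%N + prime_sum (fun q => ln (INR q) / (INR q - 1)) (nth_prime r).
  elim: r => [|r IH]; last by rewrite hS IH prime_sum_nth_primeS /a /p; ring.
  by rewrite /prime_sum big_mkcond unlock /=; ring.
have [C HC] := prime_sum_nth_prime_bounded.
have hl r : Rabs (h r - ln (p r)) <= Rabs (h 0%N) + C.
  rewrite hE (_ : _ - _ = h 0%N + (prime_sum (fun q => ln (INR q) / (INR q - 1))
    (nth_prime r) - ln (p r))); last by ring.
  by apply: Rle_trans (Rabs_triang _ _) _; apply: Rplus_le_compat_l; apply: HC.
have [r0 H] := eventually_dominated l_ge a0 ln_nth_prime_infty hl hS GS.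
exists r0 => r r0r; have [G0 Glt] := H r r0r; have [G'0 _] := H r.+1 (leqW r0r).
have absE s : 0 <= G s -> Rabs (gamma s 1%N) = density s * G s.
  have d0 := density_gt0 s; move=> Gs.
  rewrite -Rabs_Ropp (_ : - gamma s 1%N = density s * G s); last by rewrite /G; field; lra.
  by apply: Rabs_pos_eq; apply: Rmult_le_pos; lra.
rewrite !absE // densityS GS -/(p r).
(* Since (1 - 1/p) a = ln p / p, the gain from r to r + 1 is a positive multiple of the gap in
   [Glt]. *)
have -> : density r * (1 - / p r) * (G r + a r * (h r - ln (p r) / 2)) =
    density r * G r + density r / p r * (h r * ln (p r) - ln (p r) ^ 2 / 2 - G r).
  by rewrite /a; field; have := p2 r; lra.
suff : 0 < density r / p r * (h r * ln (p r) - ln (p r) ^ 2 / 2 - G r) by lra.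
apply: Rmult_lt_0_compat; last by lra.
by apply: Rdiv_lt_0_compat; have := p2 r; have := density_gt0 r; lra.
Qed.
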